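(* Let $R\in\mathbb{R}^{m\times n}$ and $b\in\mathbb{R}^m$ with $n=lc$, let $M\in\mathbb{R}^{n\times n}$ be symmetric positive-definite, and let $x_0\in\mathbb{R}^n$, $a\in(0,1)$, $\gamma\in(0,\infty)$ and $K\in\mathbb{N}$. Let $$\varepsilon_0=\min_{x\in\mathbb{R}^n}\|Rx-b\|^2 .$$ Then for every positive number $\varepsilon$ with $\varepsilon>\varepsilon_0$, the algorithm $\mathrm{SupPCG}(x_0,a,\gamma,K,\varepsilon)$ defined in the context terminates within a finite number of iterations.
   Context: $\|\cdot\|$ is the Euclidean norm. Put $f(x)=\|Rx-b\|^2$, $A=R^TR$, $y=R^Tb$. Total variation. A vector $v\in\mathbb{R}^n$, $n=lc$, represents an image with $l$ rows and $c$ columns; $[v]_{i,j}$ is the $(c(i-1)+j)$th component of $v$. Define $$TV(v)=\sum_{i=1}^{l-1}\sum_{j=1}^{c-1}\sqrt{([v]_{i,j}-[v]_{i+1,j})^2+([v]_{i,j}-[v]_{i,j+1})^2}.$$ Nonascending vectors. $t\in\mathbb{R}^n$ is a nonascending vector for $TV$ at $v\in\mathbb{R}^n$ if $\|t\|\le 1$ and there is $\Delta>0$ such that $TV(v+\delta t)\le TV(v)$ for all $\delta\in[0,\Delta]$. The set of these is denoted $\tilde\partial TV(v)$ (it always contains the zero vector). Procedure $\mathrm{S}_{TV}(x,\ell,a,\gamma,K)$ (where $x\in\mathbb{R}^n$, $\ell$ is a nonnegative integer): set $v\leftarrow x$. For $i=1,\dots,K$ do: choose $t\in\tilde\partial TV(v)$;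 repeat [$\tilde\gamma\leftarrow\gamma a^{\ell}$; $\tilde v\leftarrow v+\tilde\gamma t$; $\ell\leftarrow\ell+1$] until $TV(\tilde v)\le TV(v)$; then set $v\leftarrow\tilde v$. Return $(v-x,\ell)$ (with the final value of $\ell$). Procedure $\mathrm{U}_{\mathrm{PCG}}(x,p,h)$: $g\leftarrow Ax-y$; $z\leftarrow Mg$; $\beta\leftarrow z^Th/p^Th$; $p\leftarrow -z+\beta p$; $h\leftarrow Ap$; $\alpha\leftarrow -g^Tp/p^Th$; $x\leftarrow x+\alpha p$; return $(x,p,h)$. (Assignments are sequential, each using the current values.) Algorithm $\mathrm{SupPCG}(x_0,a,\gamma,K,\varepsilon)$: $x_{1/2}\leftarrow x_0$; $g_0\leftarrow Ax_0-y$; $z_0\leftarrow Mg_0$; $p_0\leftarrow -z_0$; $h_0\leftarrow Ap_0$; $\alpha\leftarrow -g_0^Tp_0/p_0^Th_0$; $x_1\leftarrow x_0+\alpha p_0$; $k\leftarrow 1$; $\ell_1\leftarrow 0$. While $f(x_{k-1/2})>\varepsilon$ do: $(s_k,\ell_{k+1})\leftarrow \mathrm{S}_{TV}(x_k,\ell_k,a,\gamma,K)$; $x_{k+1/2}\leftarrow x_k+s_k$; $(x_{k+1},p_k,h_k)\leftarrow \mathrm{U}_{\mathrm{PCG}}(x_{k+1/2},p_{k-1},h_{k-1})$; $k\leftarrow k+1$. After the while loop ends, return $(k,x_{k-1/2})$. The algorithm terminates when the while condition fails, i.e. when $f(x_{k-1/2})\le\varepsilon$ for the current $k$. *)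

(* Defs.v *)
From HB Require Import structures.
From mathcomp Require Import all_boot all_order all_algebra.
From mathcomp Require Import reals.
Set Implicit Arguments.
Unset Strict Implicit.
Unset Printing Implicit Defensive.
Import Order.TTheory GRing.Theory Num.Theory.
Local Open Scope ring_scope.

Definition dotv (F : realType) (n : nat) (u v : 'cV[F]_n) : F :=
  (u^T *m v) 0 0.

Definition enorm (F : realType) (n : nat) (v : 'cV[F]_n) : F :=
  Num.sqrt (dotv v v).

Definition lsq (F : realType) (m n : nat) (R : 'M[F]_(m, n)) (b : 'cV[F]_m)
    (x : 'cV[F]_n) : F :=
  enorm (R *m x - b) ^+ 2.

Definition sym_posdef (F : realType) (n : nat) (M : 'M[F]_n) : Prop :=
  M^T = M /\ (forall v : 'cV[F]_n, v != 0 -> 0 < dotv v (M *m v)).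

(* Rows and columns are numbered from 0, so pixel (i, j) of an image with c
   columns is the component of index c * i + j (from 0).  The default value 0
   is returned for out-of-range indices only. *)
Definition pixel (F : realType) (n c : nat) (v : 'cV[F]_n) (i j : nat) : F :=
  if insub (c * i + j)%N is Some k then v k 0 else 0.

Definition TV (F : realType) (n l c : nat) (v : 'cV[F]_n) : F :=
  \sum_(i < l.-1) \sum_(j < c.-1)
     Num.sqrt ((pixel c v i j - pixel c v i.+1 j) ^+ 2
               + (pixel c v i j - pixel c v i j.+1) ^+ 2).

Definition nonascending (F : realType) (n l c : nat) (v t : 'cV[F]_n) : Prop :=
  enorm t <= 1 /\
  exists2 Delta : F, 0 < Delta &
    forall delta : F, 0 <= delta <= Delta ->
      TV l c (v + delta *: t) <= TV l c v.

(* Division is total, with u / 0 = 0.  Here h = A p with A = R^T R, so that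
   p^T h = 0 forces R p = 0, and both quotients below are then 0 / 0: in that
   degenerate case the step is carried out with beta = 0, resp. alpha = 0. *)
Definition U_PCG (F : realType) (m n : nat) (R : 'M[F]_(m, n)) (b : 'cV[F]_m)
    (M : 'M[F]_n) (x p h : 'cV[F]_n) : 'cV[F]_n * 'cV[F]_n * 'cV[F]_n :=
  let A := R^T *m R in
  let y := R^T *m b in
  let g := A *m x - y in
  let z := M *m g in
  let beta := dotv z h / dotv p h in
  let p' := - z + beta *: p in
  let h' := A *m p' in
  let alpha := - dotv g p' / dotv p' h' in
  (x + alpha *: p', p', h').

(* Control points of the algorithm.  In all but the last, k, p, h stand for
   k, p_(k-1), h_(k-1), and ell is the current value of that counter.
   - [While k xhalf x p h ell]: about to test the while condition,
     with xhalf = x_(k-1/2) and x = x_k;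
   - [For k x p h i v ell]: in the superiorization procedure called at x = x_k,
     i iterations of its for loop being completed;
   - [Repeat k x p h i v t ell]: about to execute the body of the repeat loop,
     in that for loop, for the chosen direction t;
   - [Return k xhalf]: the algorithm has returned (k, xhalf). *)
Inductive state (F : realType) (n : nat) : Type :=
| While (k : nat) (xhalf x p h : 'cV[F]_n) (ell : nat)
| For (k : nat) (x p h : 'cV[F]_n) (i : nat) (v : 'cV[F]_n) (ell : nat)
| Repeat (k : nat) (x p h : 'cV[F]_n) (i : nat) (v t : 'cV[F]_n) (ell : nat)
| Return (k : nat) (xhalf : 'cV[F]_n).

Definition SupPCG_init (F : realType) (m n : nat) (R : 'M[F]_(m, n))
    (b : 'cV[F]_m) (M : 'M[F]_n) (x0 : 'cV[F]_n) : state F n :=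
  let A := R^T *m R in
  let y := R^T *m b in
  let g0 := A *m x0 - y in
  let z0 := M *m g0 in
  let p0 := - z0 in
  let h0 := A *m p0 in
  let alpha := - dotv g0 p0 / dotv p0 h0 in
  let x1 := x0 + alpha *: p0 in
  While 1 x0 x1 p0 h0 0.

(* A relation rather than a function, because the choice of the nonascending
   vector t is left open. *)
Inductive SupPCG_step (F : realType) (m n l c : nat) (R : 'M[F]_(m, n))
    (b : 'cV[F]_m) (M : 'M[F]_n) (a gamma : F) (K : nat) (eps : F) :
    state F n -> state F n -> Prop :=
| step_exit k xhalf x p h ell :
    lsq R b xhalf <= eps ->
    SupPCG_step l c R b M a gamma K eps
      (While k xhalf x p h ell) (Return k xhalf)
| step_enter k xhalf x p h ell :
    lsq R b xhalf > eps ->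
    SupPCG_step l c R b M a gamma K eps
      (While k xhalf x p h ell) (For k x p h 0 x ell)
| step_choose k x p h i v t ell :
    (i < K)%N -> nonascending l c v t ->
    SupPCG_step l c R b M a gamma K eps
      (For k x p h i v ell) (Repeat k x p h i v t ell)
| step_reject k x p h i v t ell :
    ~ TV l c (v + (gamma * a ^+ ell) *: t) <= TV l c v ->
    SupPCG_step l c R b M a gamma K eps
      (Repeat k x p h i v t ell) (Repeat k x p h i v t ell.+1)
| step_accept k x p h i v t ell :
    TV l c (v + (gamma * a ^+ ell) *: t) <= TV l c v ->
    SupPCG_step l c R b M a gamma K eps
      (Repeat k x p h i v t ell)
      (For k x p h i.+1 (v + (gamma * a ^+ ell) *: t) ell.+1)
| step_update k x p h v ell s xhalf x' p' h' :
    s = v - x -> xhalf = x + s ->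
    U_PCG R b M xhalf p h = (x', p', h') ->
    SupPCG_step l c R b M a gamma K eps
      (For k x p h K v ell) (While k.+1 xhalf x' p' h' ell).

(* Maximal executions, finite or infinite; a finite one is prolonged by
   repeating its last state, which has no successor. *)
Definition maximal_execution (S : Type) (step : S -> S -> Prop) (s0 : S)
    (sigma : nat -> S) : Prop :=
  sigma 0%N = s0 /\
  forall i : nat, step (sigma i) (sigma i.+1) \/
    ((forall s, ~ step (sigma i) s) /\ sigma i.+1 = sigma i).

(* Whatever the choices made, the execution reaches a [Return] state after
   finitely many steps; in particular every inner loop that is entered halts. *)
Definition SupPCG_terminates (F : realType) (m n l c : nat)
    (R : 'M[F]_(m, n)) (b : 'cV[F]_m) (M : 'M[F]_n) (x0 : 'cV[F]_n)
    (a gamma : F) (K : nat) (eps : F) : Prop :=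
  forall sigma : nat -> state F n,
    maximal_execution (SupPCG_step l c R b M a gamma K eps)
      (SupPCG_init R b M x0) sigma ->
    exists (N k : nat) (xhalf : 'cV[F]_n), sigma N = Return k xhalf.

(* Main.v *)
Require Import Defs.
From HB Require Import structures.
From mathcomp Require Import all_boot all_order all_algebra.
From mathcomp Require Import reals.
From mathcomp Require Import ring lra.
Import Order.TTheory GRing.Theory Num.Theory.
Local Open Scope ring_scope.

Set Implicit Arguments.
Unset Strict Implicit.
Unset Printing Implicit Defensive.

(** Fix a least-squares solution [xs].  By the normal equations,
    f(x) = eps0 + E(x)^2 with E(x) = |R (x - xs)|, so it suffices to bring E
    below the square root of eps - eps0.

    The key estimate is that one update, started at a perturbed iterate v
    whereas the previous direction p was obtained at x, satisfies

      E(x') <= (1 - kappa^2 / 2) E(v) + kappa |R (v - x)|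

    for some kappa > 0 depending only on R and M ([U_PCG_contraction]).  In
    terms of images under R this is plain geometry ([conjugate_step_contraction]).
    The preconditioned residual q makes an angle bounded away from a right angle
    with the residual w = R (v - xs) ([preconditioned_gradient_angle]).
    Conjugation with respect to p only shortens the direction, and spoils its
    descent by at most |R (v - x)| |q|, since the exact line search at x made
    R (x - xs) orthogonal to R p.  Exact minimization then removes from E^2 at least
    the square of kappa E(v) - |R (v - x)|, when that number is nonnegative.

    The total length of the superiorization steps is bounded by a geometric
    series; let rem(ell) be its tail from the current exponent on, and let L
    bound the norm of R.  Inside the superiorization procedure,

      E(v) + kappa |R (v - x)| + (1 + kappa) L rem(ell)

    never increases, because a trial consumes at least as much of the tail as it
    moves v; by the key estimate an update at v lowers this potential by at least
    kappa^2 E(v) / 2.  As the potential is nonnegative, only finitely many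
    updates start from a v with E(v) bounded below ([while_inevitable]).

    It remains to see that the inner loops halt and that no state but a returned
    one is stuck: the zero vector is always nonascending, and the trial steps
    tend to zero, hence are accepted eventually ([repeat_inevitable]). *)

(** * Euclidean geometry of column vectors *)

Lemma dotvE (F : realType) (n : nat) (u v : 'cV[F]_n) :
  dotv u v = \sum_i u i 0 * v i 0.
Proof. by rewrite /dotv mxE; apply: eq_bigr => i _; rewrite mxE. Qed.

Lemma dotvC (F : realType) (n : nat) (u v : 'cV[F]_n) : dotv u v = dotv v u.
Proof. by rewrite !dotvE; apply: eq_bigr => i _; rewrite mulrC. Qed.

Lemma dotvDl (F : realType) (n : nat) (u v w : 'cV[F]_n) :
  dotv (u + v) w = dotv u w + dotv v w.
Proof. by rewrite /dotv linearD mulmxDl mxE. Qed.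

Lemma dotvZl (F : realType) (n : nat) (k : F) (u v : 'cV[F]_n) :
  dotv (k *: u) v = k * dotv u v.
Proof. by rewrite /dotv linearZ -scalemxAl mxE. Qed.

Lemma dotvNl (F : realType) (n : nat) (u v : 'cV[F]_n) :
  dotv (- u) v = - dotv u v.
Proof. by rewrite -scaleN1r dotvZl mulN1r. Qed.

Lemma dotvDr (F : realType) (n : nat) (u v w : 'cV[F]_n) :
  dotv u (v + w) = dotv u v + dotv u w.
Proof. by rewrite dotvC dotvDl !(dotvC u). Qed.

Lemma dotvZr (F : realType) (n : nat) (k : F) (u v : 'cV[F]_n) :
  dotv u (k *: v) = k * dotv u v.
Proof. by rewrite dotvC dotvZl (dotvC u). Qed.

Lemma dotvNr (F : realType) (n : nat) (u v : 'cV[F]_n) :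
  dotv u (- v) = - dotv u v.
Proof. by rewrite dotvC dotvNl (dotvC u). Qed.

Definition dotv_lin := (dotvDl, dotvDr, dotvNl, dotvNr, dotvZl, dotvZr).

Lemma dotv_trmx (F : realType) (m n : nat) (B : 'M[F]_(m, n)) u v :
  dotv (B^T *m u) v = dotv u (B *m v).
Proof. by rewrite /dotv trmx_mul trmxK mulmxA. Qed.

Lemma dotvv_ge0 (F : realType) (n : nat) (u : 'cV[F]_n) : 0 <= dotv u u.
Proof. by rewrite dotvE sumr_ge0 // => i _; rewrite -expr2 sqr_ge0. Qed.

Lemma dotvv_eq0 (F : realType) (n : nat) (u : 'cV[F]_n) :
  dotv u u = 0 -> u = 0.
Proof.
move/eqP; rewrite dotvE psumr_eq0 => [|i _]; last by rewrite -expr2 sqr_ge0.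
move/allP => u0; apply/colP => i; rewrite mxE.
have := u0 i; rewrite mem_index_enum => /(_ isT).
by rewrite mulf_eq0 orbb => /eqP.
Qed.

Lemma dotv0l (F : realType) (n : nat) (v : 'cV[F]_n) : dotv 0 v = 0.
Proof. by rewrite -(scale0r 0) dotvZl mul0r. Qed.

Lemma dotv0r (F : realType) (n : nat) (v : 'cV[F]_n) : dotv v 0 = 0.
Proof. by rewrite dotvC dotv0l. Qed.

Lemma enorm_ge0 (F : realType) (n : nat) (u : 'cV[F]_n) : 0 <= enorm u.
Proof. exact: sqrtr_ge0. Qed.

Lemma enorm_sqr (F : realType) (n : nat) (u : 'cV[F]_n) :
  enorm u ^+ 2 = dotv u u.
Proof. by rewrite sqr_sqrtr // dotvv_ge0. Qed.

Lemma enorm_le_sqr (F : realType) (m n : nat) (k : F) (u : 'cV[F]_m)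
    (v : 'cV[F]_n) :
  0 <= k -> enorm u <= k * enorm v -> dotv u u <= k ^+ 2 * dotv v v.
Proof.
move=> k0 uv; rewrite -!enorm_sqr -exprMn.
by rewrite ler_pXn2r // nnegrE ?mulr_ge0 ?enorm_ge0.
Qed.

Lemma enorm0 (F : realType) (n : nat) : enorm (0 : 'cV[F]_n) = 0.
Proof. by rewrite /enorm dotv0l sqrtr0. Qed.

Lemma enormZ (F : realType) (n : nat) (k : F) (u : 'cV[F]_n) :
  enorm (k *: u) = `|k| * enorm u.
Proof.
by rewrite /enorm dotvZl dotvZr mulrA -expr2 sqrtrM ?sqr_ge0 // sqrtr_sqr.
Qed.

(** Expand the squared norm of |v|^2 u - <u, v> v. *)
Lemma cauchy_schwarz_sqr (F : realType) (n : nat) (u v : 'cV[F]_n) :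
  dotv u v ^+ 2 <= dotv u u * dotv v v.
Proof.
have [v0|vN0] := eqVneq (dotv v v) 0.
  by rewrite (dotvv_eq0 v0) !dotv0r expr0n mulr0.
have v_gt0 : 0 < dotv v v by rewrite lt_def vN0 dotvv_ge0.
rewrite -subr_ge0 -(pmulr_rge0 _ v_gt0).
have := dotvv_ge0 (dotv v v *: u - dotv u v *: v).
by rewrite !dotv_lin (dotvC v u) => h; lra.
Qed.

Lemma cauchy_schwarz (F : realType) (n : nat) (u v : 'cV[F]_n) :
  dotv u v <= enorm u * enorm v.
Proof.
rewrite -sqrtrM ?dotvv_ge0 // (le_trans (ler_norm _)) // -sqrtr_sqr.
by rewrite ler_wsqrtr // cauchy_schwarz_sqr.
Qed.

Lemma enorm_triangle (F : realType) (n : nat) (u v : 'cV[F]_n) :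
  enorm (u + v) <= enorm u + enorm v.
Proof.
rewrite -(ler_pXn2r (ltn0Sn 1)) ?nnegrE ?addr_ge0 ?enorm_ge0 // enorm_sqr.
rewrite !dotv_lin sqrrD !enorm_sqr (dotvC v u).
by have := cauchy_schwarz u v; lra.
Qed.

(** The Frobenius norm is a bound, by the Cauchy-Schwarz inequality on each
    row; 1 is added to its square so as to get a positive bound without a
    square root. *)
Lemma mulmx_bounded (F : realType) (m n : nat) (B : 'M[F]_(m, n)) :
  exists2 L : F, 0 < L & forall v, enorm (B *m v) <= L * enorm v.
Proof.
pose S := \sum_i dotv (row i B)^T (row i B)^T.
have S_ge0 : 0 <= S by apply: sumr_ge0 => i _; exact: dotvv_ge0.
exists (S + 1) => [|v]; first by lra.
rewrite -(ler_pXn2r (ltn0Sn 1)) ?nnegrE ?mulr_ge0 ?enorm_ge0 //; last by lra.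
rewrite exprMn !enorm_sqr.
apply: (@le_trans _ _ (S * dotv v v)); last first.
  by apply: ler_wpM2r; [exact: dotvv_ge0 | nra].
rewrite [leLHS]dotvE mulr_suml; apply: ler_sum => i _.
have -> : (B *m v) i 0 = dotv (row i B)^T v.
  by rewrite mxE dotvE; apply: eq_bigr => j _; rewrite !mxE.
by rewrite -expr2 cauchy_schwarz_sqr.
Qed.

(** * Exact line search along a conjugate direction *)

Lemma line_search_orthogonal (F : realType) (m : nat) (w r : 'cV[F]_m) :
  dotv (w + (- dotv w r / dotv r r) *: r) r = 0.
Proof.
rewrite !dotv_lin; have [r0|rN0] := eqVneq (dotv r r) 0.
  by rewrite (dotvv_eq0 r0) !dotv0r mulr0 addr0.
by rewrite divfK // subrr.
Qed.

(** The quadratic decrease becomes a linear contraction because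
    E'^2 <= E^2 - u^2 implies E' <= E - u^2 / (2 E), and u^2 is at least
    kappa^2 E^2 - 2 kappa E sigma.  When u is negative, sigma alone dominates
    kappa E, and E' <= E suffices. *)
Lemma contraction_of_decrease (F : realType) (kappa E E' sigma : F) :
  0 < kappa -> 0 <= sigma -> 0 <= E' <= E ->
  (0 <= kappa * E - sigma -> E' ^+ 2 <= E ^+ 2 - (kappa * E - sigma) ^+ 2) ->
  E' <= (1 - kappa ^+ 2 / 2) * E + kappa * sigma.
Proof.
move=> k0 s0 /andP[E'0 E'E] decr.
have [u0|u0] := leP 0 (kappa * E - sigma); last by nra.
have {}decr := decr u0.
have [E0|E0] := eqVneq E 0; first by nra.
have {}E0 : 0 < E by lra.
rewrite -(ler_pM2l E0).
have : 0 <= (E - E') ^+ 2 by exact: sqr_ge0.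
have : 0 <= sigma ^+ 2 by exact: sqr_ge0.
by nra.
Qed.

(** Here [w], [s], [pi] and [q] are the images under R of the error at the
    perturbed iterate, of the perturbation, of the previous direction and of the
    preconditioned gradient.  The two hypotheses on [q] contain the angle
    condition kappa |w| |q| <= <w, q>, and force [w] = 0 when [q] = 0: this is
    what settles the degenerate case [r] = 0, where the step is void. *)
Lemma conjugate_step_contraction (F : realType) (m : nat) (kappa : F)
    (w s pi q : 'cV[F]_m) :
  let r := - q + (dotv q pi / dotv pi pi) *: pi in
  0 < kappa ->
  kappa * dotv w w <= dotv w q -> kappa * dotv q q <= dotv w q ->
  dotv (w - s) pi = 0 ->
  enorm (w + (- dotv w r / dotv r r) *: r)
    <= (1 - kappa ^+ 2 / 2) * enorm w + kappa * enorm s.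
Proof.
set beta := _ / _ => /=; set r := - q + _ => k0 hw hq /eqP.
rewrite dotvDl dotvNl subr_eq0 => /eqP wpi.
(* Both sides vanish in the degenerate case pi = 0, where beta is 0 / 0. *)
have bpi : beta * (beta * dotv pi pi) = beta * dotv q pi.
  have [p0|pN0] := eqVneq (dotv pi pi) 0.
    by rewrite (dotvv_eq0 p0) !dotv0r !mulr0.
  by rewrite [X in _ * X]divfK.
have rr : dotv r r = dotv q q - dotv (beta *: pi) (beta *: pi).
  by rewrite /r !dotv_lin (dotvC pi q); lra.
have r_le : dotv r r <= dotv q q by rewrite rr gerBl dotvv_ge0.
(* Up to sign, r is q stripped of its component along pi, which is therefore at
   most as long as q. *)
have s_le : dotv s (beta *: pi) <= enorm s * enorm q.
  rewrite (le_trans (cauchy_schwarz _ _)) // ler_wpM2l ?enorm_ge0 //.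
  by rewrite ler_wsqrtr // -subr_ge0 -rr dotvv_ge0.
have wr : - dotv w r = dotv w q - dotv s (beta *: pi).
  by rewrite /r !dotv_lin wpi; ring.
have angle : kappa * (enorm w * enorm q) <= dotv w q.
  have : 0 <= (enorm w - enorm q) ^+ 2 by exact: sqr_ge0.
  move: hw hq; rewrite -!enorm_sqr.
  by move: (enorm w) (enorm q) (dotv w q) => x y z; nra.
have descent : enorm q * (kappa * enorm w - enorm s) <= - dotv w r.
  by rewrite wr; lra.
clearbody r; set w' := w + _.
have w'2 : enorm w' ^+ 2 * dotv r r = dotv w w * dotv r r - dotv w r ^+ 2.
  rewrite enorm_sqr /w'; have [r0|rN0] := eqVneq (dotv r r) 0.
    by rewrite (dotvv_eq0 r0) !dotv0r !mulr0 expr0n subr0.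
  by rewrite !dotv_lin (dotvC r w); field.
have [r0|rN0] := eqVneq (dotv r r) 0.
  have ww' : w' = w by rewrite /w' (dotvv_eq0 r0) scaler0 addr0.
  have uq : enorm q * (kappa * enorm w - enorm s) <= 0.
    by rewrite (le_trans descent) // (dotvv_eq0 r0) dotv0r oppr0.
  have u0 : kappa * enorm w - enorm s <= 0.
    have [q0|qN0] := eqVneq (enorm q) 0; last first.
      by move: uq; rewrite pmulr_rle0 // lt_def qN0 enorm_ge0.
    have dq0 : dotv q q = 0 by rewrite -enorm_sqr q0 expr0n.
    have dw0 : dotv w w = 0.
      apply/eqP; rewrite eq_le dotvv_ge0 andbT -(pmulr_rle0 _ k0).
      by rewrite (le_trans hw) // (dotvv_eq0 dq0) dotv0r.
    by rewrite (dotvv_eq0 dw0) enorm0; have := enorm_ge0 s; lra.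
  apply: contraction_of_decrease => //; rewrite ?ww' ?enorm_ge0 ?lexx //=.
  move=> u0'; have uu : kappa * enorm w - enorm s = 0 by lra.
  by rewrite uu expr0n /= subr0.
have r0 : 0 < dotv r r by rewrite lt_def rN0 dotvv_ge0.
apply: contraction_of_decrease => //; rewrite ?enorm_ge0 //=.
  rewrite -(ler_pXn2r (ltn0Sn 1)) ?nnegrE ?enorm_ge0 // -(ler_pM2r r0) w'2.
  by rewrite enorm_sqr gerBl sqr_ge0.
move=> u0; rewrite -(ler_pM2r r0) w'2 mulrBl enorm_sqr lerD2l lerN2.
have := ler_wpM2l (sqr_ge0 (kappa * enorm w - enorm s)) r_le.
move/le_trans; apply; rewrite -[X in _ <= X]sqrrN -enorm_sqr -exprMn mulrC.
rewrite ler_pXn2r // nnegrE ?mulr_ge0 ?enorm_ge0 //.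
by rewrite (le_trans _ descent) ?mulr_ge0 ?enorm_ge0.
Qed.

(** * Bounds on the preconditioner *)

Lemma mulmx_pinvmxK (F : fieldType) (m n k : nat) (B : 'M[F]_(m, n))
    (e : 'M[F]_(n, k)) :
  B *m (pinvmx B *m (B *m e)) = B *m e.
Proof.
have BPB : B *m pinvmx B *m B = B by rewrite mulmxKpV.
by move: (pinvmx B) BPB => P BPB; rewrite !mulmxA BPB.
Qed.

(** On its range B B^T is bounded below, although B may have any rank: with a
    generalized inverse P, a vector w of the range satisfies w = B P w, whence
    |w|^2 = <B^T w, P w>. *)
Lemma range_bounded_by_trmx (F : realType) (m n : nat) (B : 'M[F]_(m, n)) :
  exists2 L : F, 0 < L &
    forall e, enorm (B *m e) <= L * enorm (B^T *m (B *m e)).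
Proof.
have [L L0 bnd] := mulmx_bounded (pinvmx B).
exists L => // e; set w := B *m e.
have ww : dotv w w = dotv (B^T *m w) (pinvmx B *m w).
  by rewrite dotv_trmx mulmx_pinvmxK.
have le : dotv w w <= enorm (B^T *m w) * (L * enorm w).
  by rewrite ww (le_trans (cauchy_schwarz _ _)) // ler_wpM2l ?enorm_ge0.
have [->|wN0] := eqVneq (enorm w) 0; first by rewrite mulr_ge0 ?enorm_ge0 ?ltW.
have w0 : 0 < enorm w by rewrite lt_def wN0 enorm_ge0.
by rewrite -(ler_pM2r w0) -expr2 enorm_sqr; lra.
Qed.

Lemma posdef_form_ge0 (F : realType) (n : nat) (M : 'M[F]_n) v :
  sym_posdef M -> 0 <= dotv v (M *m v).
Proof.
move=> [_ pos]; have [->|/pos/ltW//] := eqVneq v 0.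
by rewrite mulmx0 dotv0r.
Qed.

Lemma posdef_cauchy_schwarz (F : realType) (n : nat) (M : 'M[F]_n) u v :
  sym_posdef M ->
  dotv u (M *m v) ^+ 2 <= dotv u (M *m u) * dotv v (M *m v).
Proof.
move=> hM; have [sym pos] := hM.
have [->|/pos v_gt0] := eqVneq v 0.
  by rewrite mulmx0 !dotv0r expr0n mulr0.
have symE x y : dotv x (M *m y) = dotv y (M *m x).
  by rewrite -dotv_trmx sym dotvC.
rewrite -subr_ge0 -(pmulr_rge0 _ v_gt0).
have := posdef_form_ge0 (dotv v (M *m v) *: u - dotv u (M *m v) *: v) hM.
rewrite mulmxDr mulmxN -!scalemxAr !dotv_lin (symE v u) => h; lra.
Qed.

(** With z = M g, the Cauchy-Schwarz inequality for the form M gives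
    |z|^4 = <z, M g>^2 <= <z, M z> <g, M g>, and <z, M z> is at most a multiple
    of |z|^2. *)
Lemma posdef_image_bounded (F : realType) (n : nat) (M : 'M[F]_n) :
  sym_posdef M ->
  exists2 L : F, 0 < L &
    forall g, dotv (M *m g) (M *m g) <= L * dotv g (M *m g).
Proof.
move=> hM; have [sym _] := hM; have [L L0 bnd] := mulmx_bounded M.
exists L => // g; set z := M *m g.
have [->|zN0] := eqVneq (dotv z z) 0.
  by rewrite mulr_ge0 ?posdef_form_ge0 ?ltW.
have z0 : 0 < dotv z z by rewrite lt_def zN0 dotvv_ge0.
have zM : dotv z (M *m z) <= L * dotv z z.
  apply: le_trans (cauchy_schwarz _ _) _.
  by rewrite -enorm_sqr expr2 mulrCA ler_wpM2l ?enorm_ge0.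
have := posdef_cauchy_schwarz z g hM; rewrite -/z => cs.
rewrite -(ler_pM2l z0) -expr2 (le_trans cs) //.
by rewrite mulrA ler_wpM2r ?posdef_form_ge0 // mulrC.
Qed.

(** A generalized inverse P of M is a left inverse: u = P M g - g satisfies
    M u = 0, hence <u, M u> = 0 and u = 0. *)
Lemma posdef_inverse_bounded (F : realType) (n : nat) (M : 'M[F]_n) :
  sym_posdef M ->
  exists2 L : F, 0 < L & forall g, enorm g <= L * enorm (M *m g).
Proof.
move=> [_ pos]; have [L L0 bnd] := mulmx_bounded (pinvmx M).
exists L => // g; suff {1}<- : pinvmx M *m (M *m g) = g by exact: bnd.
apply/eqP; rewrite -subr_eq0; apply: contraT => /pos.
by rewrite mulmxBr mulmx_pinvmxK subrr dotv0r ltxx.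
Qed.

(** With g = R^T w and z = M g, one has <w, q> = <g, M g>, which dominates
    |z|^2; in turn z controls q = R z, and it controls w through g.  Asking for
    both inequalities rather than for the angle condition they imply also covers
    the case q = 0. *)
Lemma preconditioned_gradient_angle (F : realType) (m n : nat)
    (R : 'M[F]_(m, n)) (M : 'M[F]_n) :
  sym_posdef M ->
  exists2 kappa : F, 0 < kappa & forall e : 'cV[F]_n,
    let w := R *m e in let q := R *m (M *m (R^T *m w)) in
    kappa * dotv w w <= dotv w q /\ kappa * dotv q q <= dotv w q.
Proof.
move=> hM.
have [L1 L1_gt0 w_le] := range_bounded_by_trmx R.
have [L2 L2_gt0 g_le] := posdef_inverse_bounded hM.
have [L3 L3_gt0 z_le] := posdef_image_bounded hM.
have [L4 L4_gt0 q_le] := mulmx_bounded R.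
have c1 : 0 < (L1 * L2) ^+ 2 * L3 by rewrite mulr_gt0 // exprn_gt0 // mulr_gt0.
have c2 : 0 < L4 ^+ 2 * L3 by rewrite mulr_gt0 // exprn_gt0.
exists ((L1 * L2) ^+ 2 * L3 + L4 ^+ 2 * L3)^-1 => [|e w q].
  by rewrite invr_gt0 addr_gt0.
pose z := M *m (R^T *m w).
have wq : dotv w q = dotv (R^T *m w) z by rewrite dotv_trmx.
have wq_ge0 : 0 <= dotv w q by rewrite wq posdef_form_ge0.
have zz : dotv z z <= L3 * dotv w q by rewrite wq z_le.
have c_gt0 := addr_gt0 c1 c2.
have ww : dotv w w <= (L1 * L2) ^+ 2 * dotv z z.
  apply: enorm_le_sqr; first by rewrite mulr_ge0 ?ltW.
  by apply: le_trans (w_le e) _; rewrite -mulrA ler_pM2l // g_le.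
have qq : dotv q q <= L4 ^+ 2 * dotv z z.
  by apply: enorm_le_sqr (ltW L4_gt0) (q_le z).
rewrite ![_^-1 * _]mulrC !ler_pdivrMr //; split.
  apply: le_trans ww _; apply: le_trans (ler_wpM2l (sqr_ge0 _) zz) _.
  by have := mulr_ge0 (ltW c2) wq_ge0; lra.
apply: le_trans qq _; apply: le_trans (ler_wpM2l (sqr_ge0 _) zz) _.
by have := mulr_ge0 (ltW c1) wq_ge0; lra.
Qed.

(** * Normal equations and the perturbed update *)

(** Moving from [xs] against the gradient g by the step 1 / L^2, where L bounds
    R, would lower f by at least |g|^2 / L^2. *)
Lemma normal_equations (F : realType) (m n : nat) (R : 'M[F]_(m, n)) b xs :
  (forall x, lsq R b xs <= lsq R b x) -> R^T *m (R *m xs - b) = 0.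
Proof.
move=> xs_min; have [L L0 bnd] := mulmx_bounded R.
set r := R *m xs - b; set g := R^T *m r; apply: dotvv_eq0.
have gg : dotv r (R *m g) = dotv g g by rewrite -dotv_trmx.
have Rg : dotv (R *m g) (R *m g) <= L ^+ 2 * dotv g g.
  exact: enorm_le_sqr (ltW L0) (bnd g).
have t0 : 0 < (L ^+ 2)^-1 by rewrite invr_gt0 exprn_gt0.
have tL : (L ^+ 2)^-1 * L ^+ 2 = 1 by rewrite mulVf // expf_neq0 // gt_eqF.
move: (L ^+ 2)^-1 t0 tL => t t0 tL.
have := xs_min (xs - t *: g); rewrite /lsq.
have -> : R *m (xs - t *: g) - b = r - t *: (R *m g).
  by rewrite mulmxBr -scalemxAr addrAC.
rewrite -/r !enorm_sqr; clearbody r.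
rewrite !dotv_lin (dotvC _ r) gg => descent.
have tRg := ler_wpM2l (ltW t0) Rg; rewrite mulrA tL mul1r in tRg.
have := dotvv_ge0 g; move: descent tRg.
move: (dotv g g) (dotv (R *m g) _) => G H descent tRg G0.
apply/eqP; rewrite eq_le G0 andbT -(pmulr_rle0 _ t0); nra.
Qed.

Lemma lsq_pythagoras (F : realType) (m n : nat) (R : 'M[F]_(m, n)) b xs x :
  R^T *m (R *m xs - b) = 0 ->
  lsq R b x = lsq R b xs + enorm (R *m (x - xs)) ^+ 2.
Proof.
move=> normal; rewrite /lsq !enorm_sqr.
have rd : dotv (R *m xs - b) (R *m (x - xs)) = 0.
  by rewrite -dotv_trmx normal dotv0l.
have -> : R *m x - b = (R *m xs - b) + R *m (x - xs).
  by rewrite mulmxBr [RHS]addrC addrA subrK.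
move: (R *m xs - b) (R *m (x - xs)) rd => r d rd.
by rewrite !dotv_lin (dotvC d r) rd addr0 add0r.
Qed.

(** What one update hands over to the next: besides h = A p, the fact that [x]
    minimizes f on the line of direction [p], which says that the gradient at [x]
    is orthogonal to [p].  The perturbation of [x] breaks this relation. *)
Definition line_searched (F : realType) (m n : nat) (R : 'M[F]_(m, n))
    (xs x p h : 'cV[F]_n) : Prop :=
  h = R^T *m R *m p /\ dotv (R *m (x - xs)) (R *m p) = 0.

Lemma gradientE (F : realType) (m n : nat) (R : 'M[F]_(m, n)) b
    (xs x : 'cV[F]_n) :
  R^T *m (R *m xs - b) = 0 ->
  R^T *m R *m x - R^T *m b = R^T *m (R *m (x - xs)).
Proof.
rewrite !mulmxBr => /eqP; rewrite subr_eq0 => /eqP <-.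
by rewrite !mulmxA.
Qed.

Lemma dotv_gram (F : realType) (m n : nat) (R : 'M[F]_(m, n))
    (u v : 'cV[F]_n) :
  dotv u (R^T *m R *m v) = dotv (R *m u) (R *m v).
Proof. by rewrite dotvC -mulmxA dotv_trmx dotvC. Qed.

Lemma line_searched_step (F : realType) (m n : nat) (R : 'M[F]_(m, n))
    b (xs x p : 'cV[F]_n) :
  R^T *m (R *m xs - b) = 0 ->
  let h := R^T *m R *m p in
  line_searched R xs
    (x + (- dotv (R^T *m R *m x - R^T *m b) p / dotv p h) *: p) p h.
Proof.
move=> normal h; split=> //.
rewrite (gradientE _ normal) dotv_trmx dotv_gram addrAC mulmxDr -scalemxAr.
exact: line_search_orthogonal.
Qed.

Lemma U_PCG_contraction (F : realType) (m n : nat) (R : 'M[F]_(m, n)) b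
    (M : 'M[F]_n) (kappa : F) (xs x v p h x' p' h' : 'cV[F]_n) :
  R^T *m (R *m xs - b) = 0 -> 0 < kappa ->
  (forall e : 'cV[F]_n,
    let w := R *m e in let q := R *m (M *m (R^T *m w)) in
    kappa * dotv w w <= dotv w q /\ kappa * dotv q q <= dotv w q) ->
  line_searched R xs x p h ->
  U_PCG R b M v p h = (x', p', h') ->
  line_searched R xs x' p' h' /\
  enorm (R *m (x' - xs)) <= (1 - kappa ^+ 2 / 2) * enorm (R *m (v - xs))
                            + kappa * enorm (R *m (v - x)).
Proof.
move=> normal k0 angle [-> orth] [<- <- <-]; split.
  exact: line_searched_step.
have [hw hq] := angle (v - xs).
have wpi : dotv (R *m (v - xs) - R *m (v - x)) (R *m p) = 0.
  by rewrite -mulmxBr opprB addrC subrKA.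
have := conjugate_step_contraction k0 hw hq wpi.
have image_x' k u : R *m (v + k *: u - xs) = R *m (v - xs) + k *: (R *m u).
  by rewrite addrAC mulmxDr -scalemxAr.
have image_p' k z : R *m (- z + k *: p) = - (R *m z) + k *: (R *m p).
  by rewrite mulmxDr mulmxN -scalemxAr.
by rewrite (gradientE _ normal) image_x' !dotv_gram dotv_trmx !image_p'.
Qed.

(** * Termination *)

(** The branching-time modality: every maximal run from [s] meets [Q].  A state
    that is not in [Q] must have a successor, so that deadlocks are excluded
    along with infinite runs. *)
Inductive inevitable (S : Type) (step : S -> S -> Prop) (Q : S -> Prop)
    (s : S) : Prop :=
| inevitable_now of Q s
| inevitable_later of (exists s', step s s')
    & (forall s', step s s' -> inevitable step Q s').

Lemma inevitable_execution (S : Type) (step : S -> S -> Prop) (Q : S -> Prop)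
    (s0 : S) (sigma : nat -> S) :
  inevitable step Q s0 -> maximal_execution step s0 sigma ->
  exists N, Q (sigma N).
Proof.
move=> inev [sigma0 run]; rewrite -sigma0 in inev.
move: {sigma0} 0%N inev => i; move: {-1}(sigma i) (erefl (sigma i)) => s si inev.
elim: inev i si => {s}[s Qs|s [s' ss'] _ IH] i si.
  by exists i; rewrite si.
have [next|[stuck _]] := run i.
  by apply: IH (erefl (sigma i.+1)); rewrite -si.
by case: (stuck s'); rewrite si.
Qed.

(** From Bernoulli's inequality, in a form that avoids inverting [a]. *)
Lemma geometric_small (F : realType) (a e : F) :
  0 < a < 1 -> 0 < e -> exists N, a ^+ N <= e.
Proof.
move=> /andP[a0 a1] e0.
have bernoulli N : a ^+ N * (1 + N%:R * (1 - a)) <= 1.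
  elim: N => [|N IH]; first by rewrite expr0; lra.
  have aN1 : a ^+ N.+1 <= 1 by rewrite exprn_ile1 ?ltW.
  have := ler_wpM2l (ltW a0) IH; rewrite mulrA -exprS -natr1 => IHa.
  by move: (a ^+ N.+1) aN1 IHa => A; nra.
have N_gt := truncnS_gt (e * (1 - a))^-1.
set N := (Num.truncn _).+1 in N_gt; exists N.
have ea0 : 0 < e * (1 - a) by rewrite mulr_gt0 // subr_gt0.
have : 1 < N%:R * (e * (1 - a)).
  by rewrite -(ltr_pM2r ea0) mulVf ?lt0r_neq0 in N_gt.
have := bernoulli N; have := exprn_gt0 N a0.
by move: (a ^+ N) (N%:R : F) => A B; nra.
Qed.

Definition is_return (F : realType) (n : nat) (s : state F n) : Prop :=
  exists k xhalf, s = Return k xhalf.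

Lemma while_step (F : realType) (m n l c : nat) (R : 'M[F]_(m, n)) b M
    (a gamma : F) K eps k xhalf x p h ell s :
  SupPCG_step l c R b M a gamma K eps (While k xhalf x p h ell) s ->
  lsq R b xhalf <= eps /\ s = Return k xhalf \/
  eps < lsq R b xhalf /\ s = For k x p h 0 x ell.
Proof. by move=> st; inversion st; subst; [left | right]. Qed.

Lemma for_step (F : realType) (m n l c : nat) (R : 'M[F]_(m, n)) b M
    (a gamma : F) K eps k x p h i v ell s :
  SupPCG_step l c R b M a gamma K eps (For k x p h i v ell) s ->
  (i < K)%N /\ (exists2 t, nonascending l c v t
                & s = Repeat k x p h i v t ell) \/
  i = K /\ (exists x' p' h', U_PCG R b M v p h = (x', p', h')
             /\ s = While k.+1 v x' p' h' ell).
Proof.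
have xE : x + (v - x) = v by rewrite addrC subrK.
move=> st; inversion st; subst; first by left; split=> //; exists t.
right; split=> //; exists x', p', h'; rewrite xE; split=> //.
by rewrite -xE.
Qed.

Lemma repeat_step (F : realType) (m n l c : nat) (R : 'M[F]_(m, n)) b M
    (a gamma : F) K eps k x p h i v t ell s :
  SupPCG_step l c R b M a gamma K eps (Repeat k x p h i v t ell) s ->
  TV l c (v + (gamma * a ^+ ell) *: t) <= TV l c v
    /\ s = For k x p h i.+1 (v + (gamma * a ^+ ell) *: t) ell.+1 \/
  ~ TV l c (v + (gamma * a ^+ ell) *: t) <= TV l c v
    /\ s = Repeat k x p h i v t ell.+1.
Proof. by move=> st; inversion st; subst; [right | left]. Qed.

(** The trial lengths tend to 0, so one of them falls below the threshold of the
    nonascending vector, if none was accepted before.  The predicate [Inv] on the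
    iterate and the exponent is arbitrary: it only has to resist the rejections,
    which advance the exponent alone. *)
Lemma repeat_inevitable (F : realType) (m n l c : nat) (R : 'M[F]_(m, n))
    b M (a gamma : F) K eps Q (Inv : 'cV[F]_n -> nat -> Prop) k x p h i v t ell :
  let step := SupPCG_step l c R b M a gamma K eps in
  0 < a < 1 -> 0 < gamma ->
  nonascending l c v t ->
  (forall ell, Inv v ell -> Inv v ell.+1) ->
  (forall ell, Inv v ell ->
     inevitable step Q
       (For k x p h i.+1 (v + (gamma * a ^+ ell) *: t) ell.+1)) ->
  Inv v ell ->
  inevitable step Q (Repeat k x p h i v t ell).
Proof.
move=> step a01 g0 [_ [Delta Delta0 desc]] InvS next.
have [a0 a1] := andP a01.
have [N aN] := geometric_small a01 (divr_gt0 Delta0 g0).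
have accepted ell' : (N <= ell')%N ->
    TV l c (v + (gamma * a ^+ ell') *: t) <= TV l c v.
  move=> N_le; apply: desc; rewrite mulr_ge0 ?(exprn_ge0, ltW g0, ltW a0) //=.
  rewrite mulrC -ler_pdivlMr // (le_trans _ aN) //.
  by rewrite ler_wiXn2l ?ltW.
have [d] := ubnP (N - ell); elim: d ell => // d IH ell d_le inv.
have [acc|rej] := boolP (TV l c (v + (gamma * a ^+ ell) *: t) <= TV l c v).
  apply: inevitable_later; first by eexists; exact: step_accept acc.
  by move=> s' /repeat_step[[_ ->]|[/(_ acc)]//]; exact: next.
apply: inevitable_later; first by eexists; apply: step_reject; exact/negP.
move=> s' /repeat_step[[acc]|[_ ->]]; first by rewrite acc in rej.
apply: IH; last exact: InvS.
have : (ell < N)%N by rewrite ltnNge; apply: contra rej => /accepted.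
by move=> ell_lt; rewrite subnS prednK ?subn_gt0.
Qed.

(** Reduces the whole superiorization procedure to its exit states, about which
    all that needs to be known is an invariant of single moves. *)
Lemma superiorization_inevitable (F : realType) (m n l c : nat)
    (R : 'M[F]_(m, n)) b M (a gamma : F) K eps Q
    (Inv : 'cV[F]_n -> nat -> Prop) k x p h :
  let step := SupPCG_step l c R b M a gamma K eps in
  0 < a < 1 -> 0 < gamma ->
  (forall v ell, Inv v ell -> Inv v ell.+1) ->
  (forall v t ell, enorm t <= 1 -> Inv v ell ->
     Inv (v + (gamma * a ^+ ell) *: t) ell.+1) ->
  (forall v ell, Inv v ell -> inevitable step Q (For k x p h K v ell)) ->
  forall i v ell, (i <= K)%N -> Inv v ell ->
  inevitable step Q (For k x p h i v ell).
Proof.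
move=> step a01 g0 InvS Inv_move exit i v ell.
have [j] := ubnP (K - i); elim: j => // j IH in i v ell *.
move=> Kij; rewrite leq_eqVlt => /predU1P[-> | iK] inv; first exact: exit.
apply: inevitable_later.
  (* The zero vector is nonascending: the procedure can always proceed. *)
  exists (Repeat k x p h i v 0 ell); apply: step_choose => //.
  split; first by rewrite enorm0.
  by exists 1 => // delta _; rewrite scaler0 addr0.
move=> s' /for_step[[_ [t t_na ->]]|[iEK]]; last by rewrite iEK ltnn in iK.
have [t_le1 _] := t_na.
apply: (repeat_inevitable (Inv := Inv)) t_na _ _ inv => // [|ell' inv'].
  exact: InvS.
by apply: IH => //; [rewrite subnS prednK ?subn_gt0 | exact: Inv_move].
Qed.

(** The sum of the trial lengths gamma a^j over j >= ell. *)
Definition budget (F : realType) (a gamma : F) (ell : nat) : F :=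
  gamma / (1 - a) * a ^+ ell.

Lemma budgetS (F : realType) (a gamma : F) ell : a < 1 ->
  budget a gamma ell = gamma * a ^+ ell + budget a gamma ell.+1.
Proof. by move=> a1; rewrite /budget exprS; field; lra. Qed.

Lemma budget_ge0 (F : realType) (a gamma : F) ell :
  0 < a < 1 -> 0 < gamma -> 0 <= budget a gamma ell.
Proof.
move=> /andP[a0 a1] g0; rewrite /budget mulr_ge0 ?exprn_ge0 ?(ltW a0) //.
by rewrite divr_ge0 ?subr_ge0 ?ltW.
Qed.

(** [N] bounds the number of updates still to be made at iterates v where
    f(v) > eps: each of them lowers the potential by kappa^2 / 2 * delta, and the
    potential is nonnegative. *)
Lemma while_inevitable (F : realType) (m n l c : nat) (R : 'M[F]_(m, n)) b M
    (a gamma : F) K eps (kappa L delta : F) (xs : 'cV[F]_n) :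
  0 < a < 1 -> 0 < gamma -> 0 < kappa -> 0 < L -> 0 < delta ->
  (forall v : 'cV[F]_n, enorm (R *m v) <= L * enorm v) ->
  (forall x, eps < lsq R b x -> delta <= enorm (R *m (x - xs))) ->
  (forall x v p h x' p' h',
    line_searched R xs x p h -> U_PCG R b M v p h = (x', p', h') ->
    line_searched R xs x' p' h' /\
    enorm (R *m (x' - xs)) <= (1 - kappa ^+ 2 / 2) * enorm (R *m (v - xs))
                              + kappa * enorm (R *m (v - x))) ->
  forall N k xhalf x p h ell,
  line_searched R xs x p h ->
  enorm (R *m (x - xs)) + (1 + kappa) * L * budget a gamma ell
    <= N%:R * (kappa ^+ 2 / 2 * delta) ->
  inevitable (SupPCG_step l c R b M a gamma K eps) (@is_return F n)
    (While k xhalf x p h ell).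
Proof.
move=> a01 g0 k0 L0 d0 bnd above contr.
pose step := SupPCG_step l c R b M a gamma K eps.
pose err x := enorm (R *m (x - xs)); pose C := (1 + kappa) * L.
have {}above x : eps < lsq R b x -> delta <= err x by exact: above.
have [a0 a1] := andP a01.
have C0 : 0 <= C by rewrite mulr_ge0 ?addr_ge0 ?ltW.
have exit k xhalf x p h ell : lsq R b xhalf <= eps ->
    inevitable step (@is_return F n) (While k xhalf x p h ell).
  move=> le; apply: inevitable_later; first by eexists; exact: step_exit.
  move=> s' /while_step[[_ ->]|[gt]]; last by rewrite ltNge le in gt.
  by apply: inevitable_now; exists k, xhalf.
elim/ltn_ind=> N IH k xhalf x p h ell ls pot_le.
have [le|gt] := leP (lsq R b xhalf) eps; first exact: exit.
(* At v = x the middle term vanishes, so that the potential at the entrance is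
   the one in the statement; at the exit it is what the contraction consumes. *)
pose Inv v ell' := err v + kappa * enorm (R *m (v - x))
  + C * budget a gamma ell' <= N%:R * (kappa ^+ 2 / 2 * delta).
apply: inevitable_later; first by eexists; exact: step_enter.
move=> s' /while_step[[le]|[_ ->]]; first by rewrite ltNge le in gt.
apply: (superiorization_inevitable (Inv := Inv)) => //.
- move=> v ell'; apply: le_trans; rewrite lerD2l ler_wpM2l //.
  by rewrite [leRHS]budgetS // lerDr mulr_ge0 ?exprn_ge0 ?ltW.
- move=> v t ell' t1; apply: le_trans.
  set g := gamma * a ^+ ell'.
  have g_ge0 : 0 <= g by rewrite mulr_ge0 ?exprn_ge0 ?ltW.
  have move_le u :
      enorm (R *m (v + g *: t - u)) <= enorm (R *m (v - u)) + g * L.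
    rewrite addrAC mulmxDr -scalemxAr (le_trans (enorm_triangle _ _)) // lerD2l.
    rewrite enormZ ger0_norm // ler_wpM2l // (le_trans (bnd t)) //.
    by rewrite ger_pMr.
  have := ler_wpM2l (ltW k0) (move_le x); have := move_le xs.
  rewrite (budgetS gamma ell' a1) -/g /err /C; lra.
- move=> v ell' inv; apply: inevitable_later.
    by eexists; apply: step_update => //; apply: surjective_pairing.
  move=> s'' /for_step[[]|[_ [x' [p' [h' [step_eq ->]]]]]]; first by rewrite ltnn.
  have [le|/above delta_le] := leP (lsq R b v) eps; first exact: exit.
  have [ls' contracted] := contr _ _ _ _ _ _ _ ls step_eq.
  rewrite -/(err x') -/(err v) in contracted.
  have drop : kappa ^+ 2 / 2 * delta <= kappa ^+ 2 / 2 * err v.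
    by rewrite ler_wpM2l // divr_ge0 ?sqr_ge0.
  have bud := mulr_ge0 C0 (budget_ge0 ell' a01 g0).
  have s_ge0 := mulr_ge0 (ltW k0) (enorm_ge0 (R *m (v - x))).
  move: inv; rewrite /Inv; case: N IH {pot_le Inv} => [|N] IH.
    by rewrite mul0r; lra.
  rewrite -natr1 mulrDl mul1r => inv.
  by apply: (IH N (ltnSn N)) => //; rewrite -/(err x') -/C; lra.
- by rewrite /Inv subrr mulmx0 enorm0 mulr0 addr0.
Qed.

Theorem theorem2 (F : realType) (m n l c : nat) (hn : n = (l * c)%N)
    (R : 'M[F]_(m, n)) (b : 'cV[F]_m) (M : 'M[F]_n) (hM : sym_posdef M)
    (x0 : 'cV[F]_n) (a : F) (ha : 0 < a < 1) (gamma : F) (hgamma : 0 < gamma)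
    (K : nat) (eps0 : F)
    (heps0 : (exists x : 'cV[F]_n, lsq R b x = eps0) /\
             (forall x : 'cV[F]_n, eps0 <= lsq R b x))
    (eps : F) (heps : 0 < eps) (heps_gt : eps0 < eps) :
  SupPCG_terminates l c R b M x0 a gamma K eps.
Proof.
have [[xs xsE] xs_min] := heps0; rewrite -xsE in xs_min.
have normal := normal_equations xs_min.
have [L L0 bnd] := mulmx_bounded R.
have [kappa k0 angle] := preconditioned_gradient_angle R hM.
have gap0 : 0 < eps - eps0 by rewrite subr_gt0.
have d0 : 0 < Num.sqrt (eps - eps0) by rewrite sqrtr_gt0.
have eta0 : 0 < kappa ^+ 2 / 2 * Num.sqrt (eps - eps0).
  by rewrite mulr_gt0 // divr_gt0 // exprn_gt0.
move=> sigma run.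
suff inev : inevitable (SupPCG_step l c R b M a gamma K eps)
    (@is_return F n) (SupPCG_init R b M x0).
  have [N [k [xhalf sigmaN]]] := inevitable_execution inev run.
  by exists N, k, xhalf.
have above x :
    eps < lsq R b x -> Num.sqrt (eps - eps0) <= enorm (R *m (x - xs)).
  rewrite (lsq_pythagoras x normal) xsE => gt.
  rewrite -(ler_pXn2r (ltn0Sn 1)) ?nnegrE ?enorm_ge0 ?(ltW d0) //.
  by rewrite sqr_sqrtr ?(ltW gap0) //; lra.
have contr x v p h x' p' h' := U_PCG_contraction (x := x) (v := v) (p := p)
  (h := h) (x' := x') (p' := p') (h' := h') normal k0 angle.
rewrite /SupPCG_init; set x1 := x0 + _.
pose pot := enorm (R *m (x1 - xs)) + (1 + kappa) * L * budget a gamma 0.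
have N_gt := truncnS_gt (pot / (kappa ^+ 2 / 2 * Num.sqrt (eps - eps0))).
rewrite ltr_pdivrMr // in N_gt.
apply: (while_inevitable l c K ha hgamma k0 L0 d0 bnd above contr) (ltW N_gt).
exact: line_searched_step.
Qed.
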